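(* Let $R$ be a commutative semiring, $v:R\to M$ a surjective m-valuation, and $\varphi:R\to U$ a surjective m-supervaluation covering $v$, with tangible lift $\tilde\varphi:R\to\widetilde U$. Let $[\varphi,\tilde\varphi]$ be the set of classes $[\psi]\in\mathrm{Cov}_m(v)$ with $\varphi\le\psi\le\tilde\varphi$, and let $[0,G(\varphi)]$ be the set of ideals $\mathfrak a$ of the semiring $M$ with $\mathfrak a\subset G(\varphi)$, ordered by inclusion. Then the map $$[\varphi,\tilde\varphi]\to[0,G(\varphi)],\qquad[\psi]\mapsto G(\psi),$$ is a well defined order reversing bijection. The inverse of this map sends an ideal $\mathfrak a\subset G(\varphi)$ to the class $[\tilde\varphi_{\mathfrak a}]$ of the tangible lift $\tilde\varphi_{\mathfrak a}$ of $\varphi$ outside $\mathfrak a$.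
   Context: A supertropical monoid is a commutative monoid $(U,\cdot)$ with absorbing element $0$ and a distinguished idempotent $e=e_U$ such that $ex=0$ implies $x=0$, together with a total ordering on $eU$ compatible with multiplication and with $0\le a$ for all $a\in eU$. Then $eU$ is a bipotent semiring with unit $e$ and addition $a+b=\max(a,b)$. $\mathcal T(U):=U\setminus eU$, $\mathcal T(U)_0:=\mathcal T(U)\cup\{0\}$. An m-valuation on $R$ is a map $v:R\to M$ to a bipotent semiring $M$ with $v(0)=0$, $v(1)=1$, $v(ab)=v(a)v(b)$, $v(a+b)\le v(a)+v(b)$. An m-supervaluation is a map $\varphi:R\to U$ to a supertropical monoid with $\varphi(0)=0$, $\varphi(1)=1$, $\varphi(ab)=\varphi(a)\varphi(b)$ such that $e\varphi:R\to eU$ is an m-valuation. It covers $v:R\to M$ if $eU=M$ and $e\varphi=v$. It is surjective if $U=\varphi(R)\cup e\varphi(R)$. For m-supervaluations $\varphi:R\to U$, $\psi:R\to V$: $\varphi\ge\psi$ if for all $a,b\in R$: $\varphi(a)=\varphi(b)\Rightarrow\psi(a)=\psi(b)$; $e\varphi(a)\le e\varphi(b)\Rightarrow e\psi(a)\le e\psi(b)$; $\varphi(a)\in eU\Rightarrow\psi(a)\in eV$. $\varphi\sim\psi$ means $\varphi\ge\psi$ and $\psi\ge\varphi$; $[\psi]$ is the equivalence class of $\psi$. $\mathrm{Cov}_m(v)$ is the poset of equivalence classes of m-supervaluations covering $v$, ordered by $[\varphi]\ge[\psi]\Leftrightarrow\varphi\ge\psi$. Ghost value set: for an m-supervaluation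 $\psi:R\to V$ covering $v$, $G(\psi):=\psi(R)\cap M=\{\psi(a)\mid a\in R,\ \psi(a)=v(a)\}$. Tangible lift of $\varphi$: let $N:=\varphi(R)$ (a submonoid of $U$ containing $\mathcal T(U)_0$) and let $s:N\to\widetilde N$, $x\mapsto s(x)=\tilde x$, be a monoid isomorphism onto a copy of $N$. Let $\widetilde U=\widetilde N\cup M$ be the disjoint union of $\widetilde N$ and $M=eU$ with the zeros identified, with the given products within $\widetilde N$ and within $M$, and $\tilde x\cdot y=(ex)y$ for $x\in N$, $y\in M$; unit $\tilde1$, distinguished idempotent $e\in M$, given ordering on $M=e\widetilde U$. This is a supertropical monoid with $\mathcal T(\widetilde U)_0=\widetilde N$, and $\tilde\varphi(a):=\widetilde{\varphi(a)}$ is an m-supervaluation covering $v$. Tangible lift outside $\mathfrak a$: for an ideal $\mathfrak a$ of $M$ with $\mathfrak a\subset G(\varphi)$, the set $s(\mathfrak a)\cup M$ is an ideal of the monoid $\widetilde U$. Let $E_{\mathfrak a}$ be the equivalence relation on $\widetilde U$ with $x\sim y$ iff $x=y$, or $x,y\in s(\mathfrak a)\cup M$ and $ex=ey$. Then $\widetilde U_{\mathfrak a}:=\widetilde U/E_{\mathfrak a}$ is a supertropical monoid with ghost ideal identified with $M$, and $\tilde\varphi_{\mathfrak a}:R\to\widetilde U_{\mathfrak a}$ is $\tilde\varphi$ followed by the quotient map. Thus $\tilde\varphi_{\mathfrak a}(a)=\varphi(a)=v(a)$ if $\varphi(a)\in\mathfrak a$, and $\tilde\varphi_{\mathfrak a}(a)$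 is (the class of) $\tilde\varphi(a)$ otherwise. *)

(* Defs.v *)
From HB Require Import structures.
From mathcomp Require Import all_boot order ssralg.
From mathcomp Require Import boolp classical_sets functions.

Set Implicit Arguments.
Unset Strict Implicit.
Unset Printing Implicit Defensive.

Import Order.TTheory GRing.Theory.

Local Open Scope classical_set_scope.
Local Open Scope ring_scope.
Local Open Scope quotient_scope.

HB.mixin Record PzSemiRing_isBipotent M of GRing.PzSemiRing M := {
  bipotent : forall a b : M, a + b = a \/ a + b = b
}.

#[short(type="bipotentType")]
HB.structure Definition Bipotent :=
  {M of PzSemiRing_isBipotent M & GRing.ComPzSemiRing M}.

(* The order of a bipotent semiring. *)
Definition ble (M : bipotentType) (a b : M) : Prop := a + b = b.

Record is_ideal (M : bipotentType) (A : set M) : Prop := IsIdeal {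
  ideal0 : A 0;
  idealD : forall a b, A a -> A b -> A (a + b);
  idealM : forall m a, A a -> A (m * a) }.

Record ideal (M : bipotentType) := Ideal {
  ideal_set :> set M;
  idealP : is_ideal ideal_set }.

(* [stle] is only meaningful on the ghost ideal eU = [set x | e * x = x];
   its values elsewhere are never used. *)
HB.mixin Record Monoid_isSupertropical U of Monoid U := {
  st0 : U;
  ste : U;
  stle : rel U;
  stmulC : forall x y : U, (x * y)%g = (y * x)%g;
  stmul0 : forall x : U, (st0 * x)%g = st0;
  ste_idem : (ste * ste)%g = ste;
  ste_eq0 : forall x : U, (ste * x)%g = st0 -> x = st0;
  stle_anti : {in [pred x | (ste * x)%g == x] &, antisymmetric stle};
  stle_trans : {in [pred x | (ste * x)%g == x] & &, transitive stle};
  stle_total : {in [pred x | (ste * x)%g == x] &, total stle};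
  stle_mul : {in [pred x | (ste * x)%g == x] & &, forall x y z : U,
    stle x y -> stle (z * x)%g (z * y)%g};
  stle0 : {in [pred x | (ste * x)%g == x], forall x, stle st0 x}
}.

#[short(type="supertropicalType")]
HB.structure Definition Supertropical :=
  {U of Monoid_isSupertropical U & Monoid U}.

Arguments st0 {s}.
Arguments ste {s}.

Section Ghost.
Context (U : supertropicalType).
Implicit Types x y z : U.

Definition is_ghost x : bool := (ste * x)%g == x.

Record ghost := Ghost { gval :> U; gvalP : is_ghost gval }.

HB.instance Definition _ := [isSub for gval].
HB.instance Definition _ := [Choice of ghost by <:].

Lemma stmul0r x : (x * st0)%g = st0 :> U.
Proof. by rewrite stmulC stmul0. Qed.

Lemma is_ghost_e x : is_ghost (ste * x)%g.
Proof. by rewrite /is_ghost mulgA ste_idem. Qed.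
Lemma is_ghost0 : is_ghost st0. Proof. by rewrite /is_ghost stmul0r. Qed.
Lemma is_ghost1 : is_ghost ste. Proof. by rewrite /is_ghost ste_idem. Qed.
Lemma is_ghostM x y : is_ghost x -> is_ghost (x * y)%g.
Proof. by rewrite /is_ghost => /eqP h; rewrite mulgA h. Qed.

Definition gh x : ghost := Ghost (is_ghost_e x).
Definition g0 : ghost := Ghost is_ghost0.
Definition g1 : ghost := Ghost is_ghost1.
Definition gmul (a b : ghost) : ghost := Ghost (is_ghostM b (gvalP a)).
Definition gadd (a b : ghost) : ghost := if stle a b then b else a.

Lemma gvalE (a : ghost) : (ste * gval a)%g = gval a.
Proof. by apply/eqP; exact: gvalP a. Qed.

Lemma gle_total (a b : ghost) : stle a b || stle b a.
Proof. by apply: stle_total; exact: gvalP. Qed.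
Lemma gle_anti (a b : ghost) : stle a b -> stle b a -> a = b.
Proof.
move=> h1 h2; apply: val_inj; apply: stle_anti; rewrite ?h1 ?h2 //; exact: gvalP.
Qed.
Lemma gle_trans (a b c : ghost) : stle a b -> stle b c -> stle a c.
Proof. by apply: stle_trans; exact: gvalP. Qed.
Lemma gle_mul (a b c : ghost) : stle a b -> stle (gmul c a) (gmul c b).
Proof. by apply: stle_mul; exact: gvalP. Qed.

Lemma gaddl (a b : ghost) : stle b a -> gadd a b = a.
Proof. by rewrite /gadd; case: ifP => // h h'; rewrite (gle_anti h h'). Qed.
Lemma gaddr (a b : ghost) : stle a b -> gadd a b = b.
Proof. by rewrite /gadd => ->. Qed.

Lemma gaddC : commutative gadd.
Proof.
by move=> a b; case/orP: (gle_total a b) => h; rewrite (gaddl h) (gaddr h).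
Qed.
Lemma gaddA : associative gadd.
Proof.
move=> a b c; case/orP: (gle_total a b) => hab; case/orP: (gle_total b c) => hbc.
- by rewrite (gaddr hab) (gaddr hbc) (gaddr (gle_trans hab hbc)).
- by rewrite (gaddr hab) (gaddl hbc) (gaddr hab).
- by rewrite (gaddl hab) (gaddr hbc).
- by rewrite (gaddl hab) (gaddl hbc) (gaddl hab) (gaddl (gle_trans hbc hab)).
Qed.
Lemma gadd0 : left_id g0 gadd.
Proof. by move=> a; apply: gaddr; apply: stle0; exact: gvalP. Qed.
Lemma gmulA : associative gmul.
Proof. by move=> a b c; apply: val_inj; rewrite /= mulgA. Qed.
Lemma gmulC : commutative gmul.
Proof. by move=> a b; apply: val_inj; rewrite /= stmulC. Qed.
Lemma gmul1 : left_id g1 gmul.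
Proof. by move=> a; apply: val_inj; rewrite /= gvalE. Qed.
Lemma gmul0 : left_zero g0 gmul.
Proof. by move=> a; apply: val_inj; rewrite /= stmul0. Qed.
Lemma gmulDl : left_distributive gmul gadd.
Proof.
move=> a b c; rewrite !(gmulC _ c).
case/orP: (gle_total a b) => h.
- by rewrite (gaddr h) (gaddr (gle_mul c h)).
- by rewrite (gaddl h) (gaddl (gle_mul c h)).
Qed.

HB.instance Definition _ := GRing.isNmodule.Build ghost gaddA gaddC gadd0.
HB.instance Definition _ := GRing.Nmodule_isComPzSemiRing.Build ghost
  gmulA gmulC gmul1 gmulDl gmul0.

Lemma ghost_bipotent (a b : ghost) : a + b = a \/ a + b = b.
Proof. by rewrite /GRing.add /= /gadd; case: ifP; [right|left]. Qed.
HB.instance Definition _ := PzSemiRing_isBipotent.Build ghost ghost_bipotent.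

End Ghost.

Record mvaluation (R : comPzSemiRingType) (M : bipotentType) (v : R -> M)
    : Prop := MValuation {
  mval0 : v 0 = 0;
  mval1 : v 1 = 1;
  mvalM : forall a b, v (a * b) = v a * v b;
  mvalD : forall a b, ble (v (a + b)) (v a + v b) }.

Record msupervaluation (R : comPzSemiRingType) (U : supertropicalType)
    (phi : R -> U) : Prop := MSupervaluation {
  msv0 : phi 0 = st0;
  msv1 : phi 1 = 1%g;
  msvM : forall a b, phi (a * b) = (phi a * phi b)%g;
  msv_gh : mvaluation (fun a => gh (phi a)) }.

(* [dominates phi psi] is phi >= psi. *)
Definition dominates (R : Type) (U V : supertropicalType)
    (phi : R -> U) (psi : R -> V) : Prop :=
  forall a b : R,
    [/\ phi a = phi b -> psi a = psi b,
        stle (ste * phi a)%g (ste * phi b)%g ->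
          stle (ste * psi a)%g (ste * psi b)%g
      & is_ghost (phi a) -> is_ghost (psi a)].

(* The m-supervaluations covering v, on all supertropical monoids (of one
   universe, strictly below that of [choiceType]). The equality
   "eU = M" is rendered by a semiring isomorphism [cov_iso] identifying M with
   eU; it is unique as soon as v is surjective. *)
Record mcover (R : comPzSemiRingType) (M : bipotentType) (v : R -> M) := Cover {
  cov_car : supertropicalType;
  cov_fun :> R -> cov_car;
  cov_msv : msupervaluation cov_fun;
  cov_iso : {rmorphism M -> ghost cov_car};
  cov_bij : bijective cov_iso;
  covE : forall a, cov_iso (v a) = gh (cov_fun a) }.

Section CoverTheory.
Context (R : comPzSemiRingType) (M : bipotentType) (v : R -> M).
Implicit Types phi psi : mcover v.

(* The element m of M seen in the ghost ideal of the target of phi. *)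
Definition cov_in phi (m : M) : cov_car phi := gval (cov_iso phi m).

Definition surjective_cover phi : Prop :=
  forall x : cov_car phi, exists a, x = phi a \/ x = (ste * phi a)%g.

Definition ghost_values psi : set M := [set m | exists a, psi a = cov_in psi m].

HB.instance Definition _ := gen_eqMixin (mcover v).
HB.instance Definition _ := gen_choiceMixin (mcover v).

Lemma dominates_refl phi : dominates phi phi. Proof. by []. Qed.
Lemma dominates_trans phi1 phi2 phi3 :
  dominates phi1 phi2 -> dominates phi2 phi3 -> dominates phi1 phi3.
Proof.
by move=> h1 h2 a b; case: (h1 a b) (h2 a b) => ? ? ? [? ? ?]; split; auto.
Qed.

Definition cov_equiv phi psi : bool :=
  `[< dominates phi psi /\ dominates psi phi >].

Lemma cov_equiv_refl : reflexive cov_equiv.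
Proof. by move=> phi; apply/asboolP. Qed.
Lemma cov_equiv_sym : symmetric cov_equiv.
Proof. by move=> phi psi; apply/asboolP/asboolP => -[]. Qed.
Lemma cov_equiv_trans : transitive cov_equiv.
Proof.
move=> psi phi chi /asboolP[h1 h2] /asboolP[h3 h4]; apply/asboolP; split.
- exact: dominates_trans h1 h3.
- exact: dominates_trans h4 h2.
Qed.

Canonical cov_equiv_equiv :=
  EquivRel cov_equiv cov_equiv_refl cov_equiv_sym cov_equiv_trans.

Definition Cov := {eq_quot cov_equiv}.
HB.instance Definition _ := EqQuotient.on Cov.
HB.instance Definition _ := Choice.on Cov.

Definition cov_class phi : Cov := \pi_Cov phi.

Definition cov_le (c d : Cov) : bool := `[< dominates (repr d) (repr c) >].

Lemma cov_class_eq phi psi :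
  cov_class phi = cov_class psi <-> dominates phi psi /\ dominates psi phi.
Proof.
split=> [h|h]; last by apply/eqmodP/asboolP.
by have /eqmodP/asboolP : \pi_Cov phi = \pi_Cov psi by [].
Qed.

Lemma cov_repr phi :
  dominates (repr (cov_class phi)) phi /\ dominates phi (repr (cov_class phi)).
Proof. by apply/cov_class_eq; rewrite /cov_class reprK. Qed.

Lemma cov_le_class phi psi :
  cov_le (cov_class phi) (cov_class psi) <-> dominates psi phi.
Proof.
have [h1 h2] := cov_repr phi; have [h3 h4] := cov_repr psi.
split=> [/asboolP h|h].
- exact: dominates_trans (dominates_trans h4 h) h1.
- by apply/asboolP; exact: dominates_trans (dominates_trans h3 h) h2.
Qed.

Lemma cov_le_refl : reflexive cov_le.
Proof. by move=> c; apply/asboolP. Qed.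
Lemma cov_le_anti : antisymmetric cov_le.
Proof.
move=> c d /andP[/asboolP h1 /asboolP h2].
by rewrite -[c]reprK -[d]reprK; apply/cov_class_eq.
Qed.
Lemma cov_le_trans : transitive cov_le.
Proof.
move=> d c f /asboolP h1 /asboolP h2; apply/asboolP.
exact: dominates_trans h2 h1.
Qed.

Fact cov_display : Order.disp_t. Proof. exact: Order.Disp tt tt. Qed.
HB.instance Definition _ :=
  Order.Le_isPOrder.Build cov_display Cov cov_le_refl cov_le_anti cov_le_trans.

Lemma cov_class_le phi psi :
  (cov_class phi <= cov_class psi)%O <-> dominates psi phi.
Proof. exact: cov_le_class. Qed.

End CoverTheory.

Arguments cov_in {R M v} phi m.
Arguments cov_class {R M v} phi.

Section TangibleLift.
Context (R : comPzSemiRingType) (M : bipotentType) (v : R -> M)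
  (phi : mcover v).
Let U := cov_car phi.
Let Msv := cov_msv phi.

(* The copy of N = phi(R) is [inl], the ghost ideal is [inr]; the two zeros are
   identified by representing zero as [inr 0] only. *)
Definition tl_carrier (z : U + ghost U) : bool :=
  if z is inl x then (x != st0) && `[< exists a, phi a = x >] else true.

Record tlift := TLift { tl_val : U + ghost U; tl_valP : tl_carrier tl_val }.
HB.instance Definition _ := [isSub for tl_val].
HB.instance Definition _ := [Choice of tlift by <:].

(* The isomorphism s from N onto its copy. *)
Definition tl_s (x : U) : U + ghost U := if x == st0 then inr 0 else inl x.

Definition tl_rawmul (z w : U + ghost U) : U + ghost U :=
  match z, w with
  | inl x, inl y => tl_s (x * y)%g
  | inl x, inr y => inr (gh x * y)
  | inr x, inl y => inr (x * gh y)
  | inr x, inr y => inr (x * y)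
  end.

Lemma tl_sP (x : U) : (exists a, phi a = x) -> tl_carrier (tl_s x).
Proof. by rewrite /tl_s; case: eqP => //= /eqP -> h; apply/asboolP. Qed.

Lemma tl_mulP (z w : tlift) : tl_carrier (tl_rawmul (tl_val z) (tl_val w)).
Proof.
case: z w => [[x|x] hx] [[y|y] hy] //=; apply: tl_sP.
move: hx hy => /= /andP[_ /asboolP[a <-]] /andP[_ /asboolP[b <-]].
by exists (a * b); rewrite (msvM Msv).
Qed.

Definition tl_mul (z w : tlift) : tlift := TLift (tl_mulP z w).
Definition tl_fun (a : R) : tlift :=
  TLift (tl_sP (ex_intro (fun b => phi b = phi a) a erefl)).
Definition tl_ghost (g : ghost U) : tlift := @TLift (inr g) isT.
Definition tl_zero : tlift := tl_ghost 0.
Definition tl_e : tlift := tl_ghost 1.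
Definition tl_le (z w : tlift) : bool :=
  match tl_val z, tl_val w with
  | inr x, inr y => stle (gval x) (gval y)
  | _, _ => false
  end.

Lemma gh0 : gh (st0 : U) = 0.
Proof. by apply: val_inj; rewrite /= stmul0r. Qed.
Lemma ghM (x y : U) : gh (x * y)%g = gh x * gh y.
Proof.
apply: val_inj => /=.
rewrite -[RHS]mulgA [(x * (ste * y))%g]stmulC -[((ste * y) * x)%g]mulgA.
by rewrite [RHS]mulgA ste_idem [(y * x)%g]stmulC.
Qed.
Lemma gh1 : gh (1%g : U) = 1.
Proof. by apply: val_inj; rewrite /= mulg1. Qed.
Lemma ghK (g : ghost U) : gh (gval g) = g.
Proof. by apply: val_inj; rewrite /= gvalE. Qed.
Lemma gh_eq0 (x : U) : gh x = 0 -> x = st0.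
Proof. by move=> /(congr1 (@gval _)) /= /ste_eq0. Qed.

Lemma tl_sl (x : U) z : tl_rawmul (tl_s x) z =
  match z with inl y => tl_s (x * y)%g | inr y => inr (gh x * y) end.
Proof.
rewrite /tl_s; case: eqP => [->|//]; case: z => y /=.
- by rewrite stmul0 eqxx mul0r.
- by rewrite gh0 mul0r.
Qed.

Lemma tl_rawmul_s (x y : U) :
  match tl_s y with inl z => tl_s (x * z)%g | inr z => inr (gh x * z) end
  = tl_s (x * y)%g.
Proof.
rewrite /tl_s; case: (eqVneq y) => [->|//].
by rewrite mulr0 stmul0r eqxx.
Qed.

Lemma tl_rawmulC : commutative tl_rawmul.
Proof. by move=> [x|x] [y|y] //=; rewrite 1?stmulC 1?mulrC. Qed.

Lemma tl_rawmulA : associative tl_rawmul.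
Proof.
move=> [x|x] [y|y] [z|z].
- by rewrite [tl_rawmul (inl y) _]/= [tl_rawmul (inl x) (inl y)]/= tl_sl
    tl_rawmulC tl_sl [((y * z) * x)%g]stmulC mulgA.
- by rewrite [tl_rawmul (inl x) (inl y)]/= tl_sl /= ghM mulrA.
- by rewrite /= mulrA.
- by rewrite /= mulrA.
- by rewrite [tl_rawmul (inl y) _]/= tl_rawmulC tl_sl /= ghM mulrC mulrA.
- by rewrite /= mulrA.
- by rewrite /= mulrA.
- by rewrite /= mulrA.
Qed.

Lemma tl_mulC : commutative tl_mul.
Proof. by move=> z w; apply: val_inj; exact: tl_rawmulC. Qed.
Lemma tl_mulA : associative tl_mul.
Proof. by move=> x y z; apply: val_inj; exact: tl_rawmulA. Qed.
Lemma tl_mul1 : left_id (tl_fun 1) tl_mul.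
Proof.
move=> [[x|x] hx]; apply: val_inj; rewrite /= (msv1 Msv) tl_sl.
- by rewrite mul1g /tl_s; move: hx => /= /andP[/negbTE ->].
- by rewrite gh1 mul1r.
Qed.
Lemma tl_1mul : right_id (tl_fun 1) tl_mul.
Proof. by move=> x; rewrite tl_mulC tl_mul1. Qed.

HB.instance Definition _ := isMonoid.Build tlift tl_mulA tl_mul1 tl_1mul.

Lemma tl_mulgC (x y : tlift) : (x * y = y * x)%g.
Proof. exact: tl_mulC. Qed.
Lemma tl_mul0 (x : tlift) : (tl_zero * x)%g = tl_zero.
Proof. by apply: val_inj; case: x => [[x|x] hx] /=; rewrite mul0r. Qed.
Lemma tl_e_idem : (tl_e * tl_e)%g = tl_e.
Proof. by apply: val_inj; rewrite /= mulr1. Qed.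
Lemma tl_e_eq0 (x : tlift) : (tl_e * x)%g = tl_zero -> x = tl_zero.
Proof.
move=> /(congr1 tl_val); case: x => [[x|x] hx] /=; rewrite mul1r => -[].
- move=> h; have /andP[/eqP nz _] := hx; case: nz.
  exact: (ste_eq0 _ h).
- by move=> h; apply: val_inj; rewrite /= h.
Qed.

Lemma tl_ghostP (x : tlift) :
  x \in [pred x | (tl_e * x)%g == x] -> {g | x = tl_ghost g}.
Proof.
case: x => [[x|x] hx]; rewrite inE => /eqP /(congr1 tl_val) //= _.
by exists x; apply: val_inj.
Qed.

Lemma tl_le_anti :
  {in [pred x | (tl_e * x)%g == x] &, antisymmetric tl_le}.
Proof.
move=> _ _ /tl_ghostP[x ->] /tl_ghostP[y ->] /andP[h1 h2].
by rewrite (gle_anti h1 h2).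
Qed.
Lemma tl_le_trans :
  {in [pred x | (tl_e * x)%g == x] & &, transitive tl_le}.
Proof.
move=> _ _ _ /tl_ghostP[x ->] /tl_ghostP[y ->] /tl_ghostP[z ->].
exact: gle_trans.
Qed.
Lemma tl_le_total : {in [pred x | (tl_e * x)%g == x] &, total tl_le}.
Proof. by move=> _ _ /tl_ghostP[x ->] /tl_ghostP[y ->]; exact: gle_total. Qed.
Lemma tl_le_mul : {in [pred x | (tl_e * x)%g == x] & &,
  forall x y z : tlift, tl_le x y -> tl_le (z * x)%g (z * y)%g}.
Proof.
move=> _ _ _ /tl_ghostP[x ->] /tl_ghostP[y ->] /tl_ghostP[z ->].
exact: gle_mul.
Qed.
Lemma tl_le0 :
  {in [pred x | (tl_e * x)%g == x], forall x, tl_le (tl_zero) x}.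
Proof. by move=> _ /tl_ghostP[x ->]; apply: stle0; exact: gvalP. Qed.

HB.instance Definition _ := Monoid_isSupertropical.Build tlift
  tl_mulgC tl_mul0 tl_e_idem tl_e_eq0
  tl_le_anti tl_le_trans tl_le_total tl_le_mul tl_le0.

Lemma tl_ghost_is_ghost g : is_ghost (tl_ghost g).
Proof. by apply/eqP; apply: val_inj; rewrite /= mul1r. Qed.
Definition tl_gh (g : ghost U) : ghost tlift := Ghost (tl_ghost_is_ghost g).

Lemma tl_gh_nmod : nmod_morphism tl_gh.
Proof.
split=> [|x y]; apply: val_inj => //=.
rewrite /GRing.add /= /gadd.
have -> : stle (tl_ghost x) (tl_ghost y) = stle (gval x) (gval y) by [].
by case: ifP.
Qed.
Lemma tl_gh_monoid : monoid_morphism tl_gh.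
Proof. by split=> [|x y]; do 2!apply: val_inj. Qed.
HB.instance Definition _ := GRing.isNmodMorphism.Build _ _ tl_gh tl_gh_nmod.
HB.instance Definition _ := GRing.isMonoidMorphism.Build _ _ tl_gh tl_gh_monoid.

Lemma tl_gh_bij : bijective tl_gh.
Proof.
have p (g : ghost tlift) : {x | gval g = tl_ghost x}.
  by apply: tl_ghostP; exact: (gvalP g).
exists (fun g => sval (p g)) => g.
- by case: (p _) => x /= /(congr1 tl_val) [->].
- by case: (p g) => x /= h; apply: val_inj.
Qed.

Lemma tl_ghE a : tl_gh (gh (phi a)) = gh (tl_fun a).
Proof.
apply: val_inj; apply: val_inj.
rewrite -[RHS]/(tl_rawmul (inr 1) (tl_s (phi a))) tl_rawmulC tl_sl.
by rewrite mulr1.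
Qed.

End TangibleLift.

Record mon_ideal (W : supertropicalType) := MonIdeal {
  mi_set :> set W;
  mi_e : mi_set ste;
  mi_mul : forall w x : W, mi_set x -> mi_set (w * x)%g }.

Section IdealQuotient.
Context (W : supertropicalType) (A : mon_ideal W).
Implicit Types x y z : W.

(* E_A for an ideal A of the monoid W containing eW; the latter holds as soon as
   A contains e. *)
Definition ieq x y : bool :=
  `[< x = y \/ [/\ mi_set A x, mi_set A y & (ste * x)%g = (ste * y)%g] >].

Lemma ieq_refl : reflexive ieq.
Proof. by move=> x; apply/asboolP; left. Qed.
Lemma ieq_sym : symmetric ieq.
Proof.
by move=> x y; apply/asboolP/asboolP => -[->|[? ? h]]; [left|right|left|right].
Qed.
Lemma ieq_trans : transitive ieq.
Proof.
move=> y x z /asboolP[->//|[hx hy h]] /asboolP[<-|[hy' hz h']];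
  apply/asboolP; right; split=> //.
by rewrite h.
Qed.
(* W / E_A, as the type of equivalence classes; [generic_quotient] would put it
   in the universe of all choice types, above that of the supertropical
   monoids. *)
Record iquot := IQuot {
  iq_class : W -> Prop;
  iq_classP : exists x, iq_class = fun y => ieq x y }.
HB.instance Definition _ := gen_eqMixin iquot.
HB.instance Definition _ := gen_choiceMixin iquot.

Definition ipi x : iquot :=
  IQuot (ex_intro (fun z => (fun y => ieq x y : Prop) = (fun y => ieq z y))
    x erefl).
Definition irepr (p : iquot) : W := sval (cid (iq_classP p)).

Lemma iq_class_inj p q : iq_class p = iq_class q -> p = q.
Proof.
case: p q => [c hc] [d hd] /= e; subst d.
by congr IQuot; exact: Prop_irrelevance.
Qed.

Lemma ipi_eq x y : ipi x = ipi y <-> ieq x y.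
Proof.
split=> [/(congr1 iq_class) /= /(congr1 (@^~ y)) /= ->|h]; first exact: ieq_refl.
apply: iq_class_inj; apply/funext => z; apply/propext; split => h'.
  by apply: ieq_trans h'; rewrite ieq_sym.
exact: ieq_trans h'.
Qed.

Lemma ireprK p : ipi (irepr p) = p.
Proof. by apply: iq_class_inj; rewrite /irepr; case: cid => x /= ->. Qed.

Definition iq_mul (p q : iquot) : iquot := ipi (irepr p * irepr q)%g.
Definition iq_le (p q : iquot) : bool :=
  stle (ste * irepr p)%g (ste * irepr q)%g.

Lemma ieqM x y x' y' : ieq x x' -> ieq y y' -> ieq (x * y)%g (x' * y')%g.
Proof.
have half a b c : ieq a b -> ieq (c * a)%g (c * b)%g.
  move=> /asboolP[->|[ha hb h]]; apply/asboolP; first by left.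
  right; split; [exact: mi_mul|exact: mi_mul|].
  by rewrite ![(c * _)%g]stmulC !mulgA h.
move=> hx hy; apply: ieq_trans (half _ _ _ hy).
by rewrite ![(_ * y)%g]stmulC; exact: half.
Qed.

Lemma ieq_e x y : ieq x y -> (ste * x)%g = (ste * y)%g.
Proof. by case/asboolP => [->|[]]. Qed.

Lemma ieq_repr x : ieq (irepr (ipi x)) x.
Proof. by apply/ipi_eq; rewrite ireprK. Qed.

Lemma ipiP (p : iquot) : {x | p = ipi x}.
Proof. by exists (irepr p); rewrite ireprK. Qed.

Lemma ipiM x y : iq_mul (ipi x) (ipi y) = ipi (x * y)%g.
Proof. by apply/ipi_eq; apply: ieqM; exact: ieq_repr. Qed.

Lemma ipi_le x y : iq_le (ipi x) (ipi y) = stle (ste * x)%g (ste * y)%g.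
Proof. by rewrite /iq_le !(ieq_e (ieq_repr _)). Qed.

Lemma iq_mulA : associative iq_mul.
Proof.
move=> p q r; have [x ->] := ipiP p; have [y ->] := ipiP q.
by have [z ->] := ipiP r; rewrite !ipiM mulgA.
Qed.
Lemma iq_mulC : commutative iq_mul.
Proof.
move=> p q; have [x ->] := ipiP p; have [y ->] := ipiP q.
by rewrite !ipiM stmulC.
Qed.
Lemma iq_mul1 : left_id (ipi 1%g) iq_mul.
Proof. by move=> p; have [x ->] := ipiP p; rewrite ipiM mul1g. Qed.
Lemma iq_1mul : right_id (ipi 1%g) iq_mul.
Proof. by move=> p; rewrite iq_mulC iq_mul1. Qed.

HB.instance Definition _ := isMonoid.Build iquot iq_mulA iq_mul1 iq_1mul.

Lemma ipi_mulg x y : (ipi x * ipi y)%g = ipi (x * y)%g.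
Proof. exact: ipiM. Qed.
Lemma iq_mulgC (p q : iquot) : (p * q = q * p)%g.
Proof. exact: iq_mulC. Qed.
Lemma iq_mul0 (p : iquot) : (ipi st0 * p)%g = ipi st0.
Proof. by have [x ->] := ipiP p; rewrite ipi_mulg stmul0. Qed.
Lemma iq_e_idem : (ipi ste * ipi ste)%g = ipi ste.
Proof. by rewrite ipi_mulg ste_idem. Qed.
Lemma iq_e_eq0 (p : iquot) : (ipi ste * p)%g = ipi st0 -> p = ipi st0.
Proof.
have [x ->] := ipiP p; rewrite ipi_mulg => /ipi_eq /ieq_e.
rewrite mulgA ste_idem stmul0r => h.
by rewrite (ste_eq0 _ h).
Qed.

Lemma mi_ghost (g : ghost W) : mi_set A (gval g).
Proof. by rewrite -gvalE stmulC; apply: mi_mul; exact: mi_e. Qed.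

Lemma iq_ghostP (p : iquot) :
  p \in [pred p | (ipi ste * p)%g == p] -> {g : ghost W | p = ipi (gval g)}.
Proof.
have [x ->] := ipiP p => hx.
have /eqP h : (ipi ste * ipi x)%g == ipi x := hx.
by exists (gh x); rewrite -[LHS]h ipi_mulg.
Qed.

Lemma ipi_gle (g h : ghost W) :
  iq_le (ipi (gval g)) (ipi (gval h)) = stle (gval g) (gval h).
Proof. by rewrite ipi_le !gvalE. Qed.

Lemma iq_le_anti :
  {in [pred p | (ipi ste * p)%g == p] &, antisymmetric iq_le}.
Proof.
move=> _ _ /iq_ghostP[g ->] /iq_ghostP[h ->]; rewrite !ipi_gle => /andP[h1 h2].
by rewrite (gle_anti h1 h2).
Qed.
Lemma iq_le_trans :
  {in [pred p | (ipi ste * p)%g == p] & &, transitive iq_le}.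
Proof.
move=> _ _ _ /iq_ghostP[g ->] /iq_ghostP[h ->] /iq_ghostP[k ->].
by rewrite !ipi_gle; exact: gle_trans.
Qed.
Lemma iq_le_total : {in [pred p | (ipi ste * p)%g == p] &, total iq_le}.
Proof.
move=> _ _ /iq_ghostP[g ->] /iq_ghostP[h ->].
by rewrite !ipi_gle; exact: gle_total.
Qed.
Lemma iq_le_mul : {in [pred p | (ipi ste * p)%g == p] & &,
  forall p q r : iquot, iq_le p q -> iq_le (r * p)%g (r * q)%g}.
Proof.
move=> _ _ _ /iq_ghostP[g ->] /iq_ghostP[h ->] /iq_ghostP[k ->].
rewrite !ipi_mulg ipi_gle => /(gle_mul k).
by rewrite -[(gval k * gval g)%g]/(gval (gmul k g))
  -[(gval k * gval h)%g]/(gval (gmul k h)) ipi_gle.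
Qed.
Lemma iq_le0 :
  {in [pred p | (ipi ste * p)%g == p], forall p, iq_le (ipi st0) p}.
Proof.
move=> _ /iq_ghostP[g ->]; rewrite ipi_le stmul0r.
by apply: stle0; exact: is_ghost_e.
Qed.

HB.instance Definition _ := Monoid_isSupertropical.Build iquot
  iq_mulgC iq_mul0 iq_e_idem iq_e_eq0
  iq_le_anti iq_le_trans iq_le_total iq_le_mul iq_le0.

Lemma iq_is_ghost (g : ghost W) : is_ghost (ipi (gval g)).
Proof. by apply/eqP; rewrite ipi_mulg gvalE. Qed.
Definition iq_gh (g : ghost W) : ghost iquot := Ghost (iq_is_ghost g).

Lemma iq_gh_nmod : nmod_morphism iq_gh.
Proof.
split=> [|x y]; apply: val_inj => //=.
rewrite /GRing.add /= /gadd.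
have -> : stle (ipi (gval x)) (ipi (gval y)) = stle (gval x) (gval y).
  exact: ipi_gle.
by case: ifP.
Qed.
Lemma iq_gh_monoid : monoid_morphism iq_gh.
Proof. by split=> [|x y]; apply: val_inj => //=; rewrite ipi_mulg. Qed.
HB.instance Definition _ := GRing.isNmodMorphism.Build _ _ iq_gh iq_gh_nmod.
HB.instance Definition _ := GRing.isMonoidMorphism.Build _ _ iq_gh iq_gh_monoid.

Lemma iq_gh_bij : bijective iq_gh.
Proof.
have p (g : ghost iquot) : {x : ghost W | gval g = ipi (gval x)}.
  by apply: iq_ghostP; exact: (gvalP g).
exists (fun g => sval (p g)) => g.
- case: (p _) => x /= /ipi_eq /ieq_e; rewrite !gvalE => h.
  by apply: val_inj; rewrite /= h.
- by case: (p g) => x /= h; apply: val_inj.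
Qed.

Lemma iq_ghE x : iq_gh (gh x) = gh (ipi x).
Proof. by apply: val_inj; rewrite /= ipi_mulg. Qed.

End IdealQuotient.

Section LiftCovers.
Context (R : comPzSemiRingType) (M : bipotentType) (v : R -> M).
Implicit Types phi psi : mcover v.

Lemma mvaluation_morph (V V' : supertropicalType) (f : R -> V) (f' : R -> V')
    (h : {rmorphism ghost V -> ghost V'}) :
  (forall a, h (gh (f a)) = gh (f' a)) ->
  mvaluation (fun a => gh (f a)) -> mvaluation (fun a => gh (f' a)).
Proof.
move=> hf [h0 h1 hM hD]; split=> [||a b|a b]; rewrite -!hf.
- by rewrite h0 rmorph0.
- by rewrite h1 rmorph1.
- by rewrite hM rmorphM.
- by rewrite /ble -!rmorphD; congr (h _); exact: hD.
Qed.

Lemma tl_fun_msv phi : msupervaluation (@tl_fun _ _ _ phi).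
Proof.
have hm := cov_msv phi; split=> //.
- by apply: val_inj; rewrite /= (msv0 hm) /tl_s eqxx.
- move=> a b; apply: val_inj.
  rewrite -[RHS]/(tl_rawmul (tl_s (phi a)) (tl_s (phi b))) tl_sl tl_rawmul_s.
  by rewrite /= (msvM hm).
- exact: mvaluation_morph (@tl_ghE _ _ _ phi) (msv_gh hm).
Qed.

Lemma tl_covE phi a :
  (@tl_gh _ _ _ phi \o cov_iso phi) (v a) = gh (@tl_fun _ _ _ phi a).
Proof. by rewrite /= covE tl_ghE. Qed.

Definition tangible_lift phi : mcover v :=
  @Cover R M v (tlift phi) (@tl_fun _ _ _ phi) (tl_fun_msv phi)
    (@tl_gh _ _ _ phi \o cov_iso phi)
    (bij_comp (@tl_gh_bij _ _ _ phi) (cov_bij phi)) (tl_covE phi).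

Lemma iq_fun_msv psi (A : mon_ideal (cov_car psi)) :
  msupervaluation (fun a => ipi A (psi a)).
Proof.
have hm := cov_msv psi; split.
- by rewrite (msv0 hm).
- by rewrite (msv1 hm).
- by move=> a b; rewrite (msvM hm) ipi_mulg.
- apply: (mvaluation_morph (h := @iq_gh _ A) _ (msv_gh hm)).
  by move=> a; exact: iq_ghE.
Qed.

Lemma iq_covE psi (A : mon_ideal (cov_car psi)) a :
  (@iq_gh _ A \o cov_iso psi) (v a) = gh (ipi A (psi a)).
Proof. by rewrite /= covE iq_ghE. Qed.

Definition quotient_cover psi (A : mon_ideal (cov_car psi)) : mcover v :=
  @Cover R M v (iquot A) (fun a => ipi A (psi a)) (iq_fun_msv A)
    (@iq_gh _ A \o cov_iso psi)
    (bij_comp (@iq_gh_bij _ A) (cov_bij psi)) (iq_covE A).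

(* The ideal s(a) U M of the tangible lift. *)
Definition lift_ideal_set phi (a : ideal M) : set (tlift phi) :=
  [set z | if tl_val z is inl x then exists2 m, ideal_set a m & x = cov_in phi m
           else True].

Lemma lift_ideal_e phi (a : ideal M) : lift_ideal_set a (ste : tlift phi).
Proof. by []. Qed.

Lemma lift_ideal_mul phi (a : ideal M) (w x : tlift phi) :
  lift_ideal_set a x -> lift_ideal_set a (w * x)%g.
Proof.
case: x => [[x|x] hx]; case: w => [[w|w] hw] //= [m am xE].
rewrite /lift_ideal_set /= /tl_s; case: eqP => // _.
have [k _ kK] := cov_bij phi.
exists (k (gh w) * m); first exact: (idealM (idealP a)).
rewrite xE /cov_in rmorphM kK /=.
by rewrite -[in LHS]gvalE !mulgA [(w * ste)%g]stmulC.
Qed.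

Definition lift_ideal phi (a : ideal M) : mon_ideal (tlift phi) :=
  MonIdeal (lift_ideal_e phi a) (@lift_ideal_mul phi a).

Definition tangible_lift_outside phi (a : ideal M) : mcover v :=
  @quotient_cover (tangible_lift phi) (lift_ideal phi a).

End LiftCovers.

(* Main.v *)
(** If [phi <= psi <= tangible_lift phi], then [psi a = psi b] holds exactly when
    [phi a = phi b], because the tangible lift separates no more points than
    [phi] does; and the covers of [v] all induce the order of [v]. Hence [psi]
    is determined up to equivalence by the set of [a] with [psi a] ghost. As
    [psi a] ghost forces [phi a] ghost, this set is in turn determined by
    [ghost_values psi]. *)
Require Import Defs.
From mathcomp Require Import all_boot order ssralg.
From mathcomp Require Import classical_sets functions.
From mathcomp Require Import boolp.

Set Implicit Arguments.
Unset Strict Implicit.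
Unset Printing Implicit Defensive.

Import GRing.Theory.

Local Open Scope classical_set_scope.

Section GhostValues.
Context (R : comPzSemiRingType) (M : bipotentType) (v : R -> M).
Implicit Types phi psi chi : mcover v.

Lemma cov_in_v psi a : cov_in psi (v a) = (ste * psi a)%g.
Proof. by rewrite /cov_in covE. Qed.

Lemma cov_in_ghost psi m : is_ghost (cov_in psi m).
Proof. exact: gvalP. Qed.

Lemma ghostE psi a : is_ghost (psi a) -> psi a = cov_in psi (v a).
Proof. by rewrite cov_in_v => /eqP. Qed.

Lemma cov_in_inj psi : injective (cov_in psi).
Proof. by move=> m n /val_inj /(bij_inj (cov_bij psi)). Qed.

Lemma cov_in_val psi a m : psi a = cov_in psi m -> v a = m.
Proof.
by move=> h; apply: (@cov_in_inj psi); rewrite cov_in_v h /cov_in gvalE.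
Qed.

Lemma ghost_valuesP psi m :
  ghost_values psi m <-> exists2 a, is_ghost (psi a) & v a = m.
Proof.
split=> [[a h]|[a h <-]]; last by exists a; exact: ghostE.
by exists a; [rewrite h; exact: cov_in_ghost | exact: cov_in_val h].
Qed.

(** On both sides the order can be read off from addition, which the isomorphism [cov_iso]
    preserves. *)
Lemma cov_in_le psi m n :
  stle (cov_in psi m) (cov_in psi n) <-> ble m n.
Proof.
rewrite /ble; split=> [h|h].
  apply: (bij_inj (cov_bij psi)); rewrite rmorphD; exact: gaddr h.
rewrite -h /cov_in rmorphD.
case/orP: (gle_total (cov_iso psi m) (cov_iso psi n)) => hle.
  by rewrite (gaddr hle : cov_iso psi m + cov_iso psi n = _)%R.
rewrite (gaddl hle : cov_iso psi m + cov_iso psi n = _)%R.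
(* Reflexivity of [stle] on ghosts is totality applied to an element and itself. *)
by case/orP: (gle_total (cov_iso psi m) (cov_iso psi m)).
Qed.

(** The order clause of domination holds between any two covers: both compare [a] and [b] as [M]
    compares [v a] and [v b]. *)
Lemma dominates_cover psi chi :
  dominates psi chi <->
  (forall a b, psi a = psi b -> chi a = chi b) /\
  (forall a, is_ghost (psi a) -> is_ghost (chi a)).
Proof.
split=> [h|[heq hg] a b]; first by split=> [a b|a]; [case: (h a b)|case: (h a a)].
split; [exact: heq | | exact: hg].
by rewrite -!cov_in_v => /cov_in_le h; apply/cov_in_le.
Qed.

Lemma ghost_values_dominates psi chi :
  dominates psi chi -> ghost_values psi `<=` ghost_values chi.
Proof.
move=> /dominates_cover[_ hg] m /ghost_valuesP[a /hg ha <-].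
by apply/ghost_valuesP; exists a.
Qed.

Lemma ghost_values_repr psi :
  ghost_values (repr (cov_class psi)) = ghost_values psi.
Proof.
have [h1 h2] := cov_repr psi.
by apply/seteqP; split; exact: ghost_values_dominates.
Qed.

(** Sums stay inside by bipotency. Surjectivity of [v] writes a multiplier as [v a], and [psi a]
    times a ghost value of [psi] is again a ghost value. *)
Lemma is_ideal_ghost_values psi :
  (forall m, exists a, v a = m) -> is_ideal (ghost_values psi).
Proof.
move=> v_surj; have hm := cov_msv psi; split.
- have [v0 _ _ _] := msv_gh hm.
  exists 0%R; rewrite (msv0 hm).
  by rewrite /cov_in rmorph0.
- by move=> m n hm1 hn; case: (bipotent m n) => ->.
- move=> m n [b hb]; have [a <-] := v_surj m.
  exists (a * b)%R; rewrite (msvM hm) hb /cov_in rmorphM /= covE /=.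
  by rewrite -[in LHS]gvalE mulgA [(psi a * ste)%g]stmulC.
Qed.

End GhostValues.

Section Interval.
Context (R : comPzSemiRingType) (M : bipotentType) (v : R -> M).
Context (phi : mcover v).
Implicit Types psi chi : mcover v.

Lemma tl_s_inj : injective (@tl_s R M v phi).
Proof.
move=> x y; rewrite /tl_s; case: (eqVneq x) => [->|_]; case: (eqVneq y) => [->|_] //.
by case.
Qed.

Lemma tangible_lift_eq a b :
  tangible_lift phi a = tangible_lift phi b <-> phi a = phi b.
Proof.
by split=> [/(congr1 (@tl_val _ _ _ _)) /tl_s_inj|h] //; apply: val_inj; rewrite /= h.
Qed.

(** Nonzero values of the lift carry the tag [inl], while a product with [e] carries [inr]; only the
    shared zero can be ghost. *)
Lemma tangible_lift_ghost a : is_ghost (tangible_lift phi a) -> phi a = st0.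
Proof.
by move=> /eqP /(congr1 (@tl_val _ _ _ _)); rewrite /= /tl_s; case: eqP.
Qed.

Lemma dominates_iff_ghost_values psi chi :
  dominates psi phi -> dominates (tangible_lift phi) chi -> dominates chi phi ->
  dominates psi chi <-> ghost_values psi `<=` ghost_values chi.
Proof.
move=> /dominates_cover[psi_eq psi_gh] /dominates_cover[chi_eq _].
move=> /dominates_cover[_ chi_gh]; split; first exact: ghost_values_dominates.
have phi_chi a b : phi a = phi b -> chi a = chi b.
  by move=> h; apply: chi_eq; apply/tangible_lift_eq.
move=> sub; apply/dominates_cover; split=> a; first by move=> b /psi_eq /phi_chi.
(* The inclusion only gives some [b] with [v b = v a] and [chi b] ghost. But [phi a] and [phi b] are
   both ghost with this common value, hence equal, and this forces [chi a = chi b]. *)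
move=> ha; have /sub/ghost_valuesP[b hb vb] : ghost_values psi (v a).
  by apply/ghost_valuesP; exists a.
by rewrite (phi_chi a b) // (ghostE (psi_gh _ ha)) (ghostE (chi_gh _ hb)) vb.
Qed.

Section Outside.
Context (A : ideal M) (A_sub : A `<=` ghost_values phi).

Lemma lift_idealE a :
  mi_set (lift_ideal phi A) (tangible_lift phi a) <->
  exists2 m, ideal_set A m & phi a = cov_in phi m.
Proof.
rewrite /= /lift_ideal_set /= /tl_s; case: eqP => [->|_] //; split=> // _.
(* The lift of zero lies in the ghost part [inr]; on the other side it is matched by the zero of
   [A]. *)
by exists 0%R; [exact: (ideal0 (idealP A)) | rewrite /cov_in rmorph0].
Qed.

(** The class of [x] is ghost when [x] is related to [e x]. Either [x = e x], which lies in the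
    monoid ideal because [e] does, or the relation itself puts [x] there. *)
Lemma tangible_lift_outside_ghost a :
  is_ghost (tangible_lift_outside phi A a) <->
  exists2 m, ideal_set A m & phi a = cov_in phi m.
Proof.
split=> [|/lift_idealE h].
  move=> /eqP; rewrite /= ipi_mulg => /ipi_eq/asboolP[h|[_ h _]].
    apply/lift_idealE; rewrite -[tangible_lift phi a]h stmulC.
    exact/mi_mul/mi_e.
  exact/lift_idealE.
apply/eqP; rewrite [LHS]ipi_mulg; apply/ipi_eq/asboolP; right; split=> //.
- exact: mi_mul.
- by rewrite mulgA ste_idem.
Qed.

Lemma ghost_values_tangible_lift_outside :
  ghost_values (tangible_lift_outside phi A) = A.
Proof.
apply/seteqP; split=> m.
  move=> /ghost_valuesP[a /tangible_lift_outside_ghost[n An /cov_in_val h] <-].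
  by rewrite h.
(* [A_sub] provides a point of [R] at which [phi] takes the ghost value [m]. *)
move=> Am; have [a ha] := A_sub Am; apply/ghost_valuesP; exists a.
  by apply/tangible_lift_outside_ghost; exists m.
exact: cov_in_val ha.
Qed.

Lemma tangible_lift_outside_le :
  dominates (tangible_lift phi) (tangible_lift_outside phi A).
Proof.
apply/dominates_cover; split=> a; first by move=> b; rewrite /= => ->.
move=> /tangible_lift_ghost h; apply/tangible_lift_outside_ghost.
by exists 0%R; [exact: (ideal0 (idealP A)) | rewrite h /cov_in rmorph0].
Qed.

Lemma tangible_lift_outside_ge : dominates (tangible_lift_outside phi A) phi.
Proof.
apply/dominates_cover; split=> a.
  move=> b h; have vE : v a = v b.
    by apply: (@cov_in_inj _ _ _ (tangible_lift_outside phi A)); rewrite !cov_in_v h.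
  (* Two lifts identified by the quotient are equal, or both come from ghost values of [phi]; these
     are fixed by [v a] and [v b], which agree. *)
  move: h => /ipi_eq/asboolP[/tangible_lift_eq //|[/lift_idealE[m _ ha]]].
  move=> /lift_idealE[n _ hb] _.
  by rewrite ha hb -(cov_in_val ha) -(cov_in_val hb) vE.
by move=> /tangible_lift_outside_ghost[m _ ->]; exact: cov_in_ghost.
Qed.

End Outside.
End Interval.

Theorem theorem2p7 (R : comPzSemiRingType) (M : bipotentType) (v : R -> M)
    (v_mval : mvaluation v) (v_surj : forall m : M, exists a : R, v a = m)
    (phi : mcover v) (phi_surj : surjective_cover phi) :
  let itv : set (Cov v) :=
    [set c | (cov_class phi <= c <= cov_class (tangible_lift phi))%O] in
  let ideals : set (set M) :=
    [set a | is_ideal a /\ a `<=` ghost_values phi] in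
  exists G : Cov v -> set M,
    [/\ forall psi : mcover v, itv (cov_class psi) ->
          G (cov_class psi) = ghost_values psi,
        set_bij itv ideals G,
        forall c d : Cov v, itv c -> itv d -> (c <= d)%O <-> G d `<=` G c
      & forall a : ideal M, a `<=` ghost_values phi ->
          itv (cov_class (tangible_lift_outside phi a)) /\
          G (cov_class (tangible_lift_outside phi a)) = a].
Proof.
move=> itv ideals.
have itvP psi : itv (cov_class psi) <->
    dominates psi phi /\ dominates (tangible_lift phi) psi.
  split=> [/andP[/cov_class_le ? /cov_class_le ?] //|[h1 h2]].
  by apply/andP; split; apply/cov_class_le.
pose G (c : Cov v) := ghost_values (repr c).
have GE psi : G (cov_class psi) = ghost_values psi by exact: ghost_values_repr.
have classP (c : Cov v) : exists psi, c = cov_class psi.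
  by exists (repr c); rewrite /cov_class reprK.
have Gle (c d : Cov v) : itv c -> itv d -> (c <= d)%O <-> G d `<=` G c.
  have [psi ->] := classP c; have [chi ->] := classP d.
  move=> /itvP[psi1 psi2] /itvP[chi1 chi2]; rewrite !GE.
  apply: iff_trans (cov_class_le _ _) _.
  exact: dominates_iff_ghost_values chi1 psi2 psi1.
have lift_itv (a : ideal M) : a `<=` ghost_values phi ->
    itv (cov_class (tangible_lift_outside phi a)) /\
    G (cov_class (tangible_lift_outside phi a)) = a.
  move=> ha; rewrite GE ghost_values_tangible_lift_outside //; split=> //.
  apply/itvP; split.
    exact: tangible_lift_outside_ge.
  exact: tangible_lift_outside_le.
exists G; split=> //; split.
- move=> c; have [psi ->] := classP c; move=> /itvP[h _]; rewrite GE; split.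
    exact: is_ideal_ghost_values.
  exact: ghost_values_dominates.
(* Injectivity is antisymmetry: equal images give both inclusions, and [Gle] turns them into both
   inequalities. *)
- move=> c d /set_mem hc /set_mem hd h; apply: Order.POrderTheory.le_anti.
  by apply/andP; split; apply/Gle => //; rewrite h.
(* The preimage is the class of the lift outside [a], so this construction inverts [G]. *)
- move=> a [a_ideal a_sub]; have [h1 h2] := lift_itv (Ideal a_ideal) a_sub.
  by exists (cov_class (tangible_lift_outside phi (Ideal a_ideal))).
Qed.
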